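(* Let $(G_i)_{i\in I}$ be a family of finite groups, indexed by an arbitrary set $I$, let $G=\bigoplus_{i\in I}G_i$ be their restricted direct product, let $\omega$ be an algebra character on $\mathrm{Z}\ell^1(G)$, and let $(\chi_i)_{i\in I}$ be the corresponding family of irreducible group characters. Then $\omega$ belongs to $c_0$ (that is, $\widetilde\omega\in c_0(G)$) if and only if $(\operatorname{mcr}(\chi_i))_{i\in I}\in c_0(I)$.
   Context: The restricted direct product $\bigoplus_{i\in I}G_i$ is the subgroup of $\prod_{i\in I}G_i$ consisting of all $(x_i)$ with $x_i=e_{G_i}$ for all but finitely many $i$, regarded as a discrete group. For a discrete group $G$, $\ell^1(G)$ is the convolution algebra with respect to counting measure and $\mathrm{Z}\ell^1(G)$ is its centre. An algebra character is a non-zero multiplicative linear functional. A group character of a finite group is the (unnormalized) trace $\chi$ of a finite-dimensional complex representation; its degree is $d_\chi=\chi(e)$. Correspondence: for each $j\in I$ the coordinate inclusion $G_j\hookrightarrow G$ induces (extension by zero) a homomorphism $\imath_j:\mathrm{Z}\ell^1(G_j)\to \mathrm{Z}\ell^1(G)$, and $\chi_j$ is the unique irreducible group character of $G_j$ with $\omega(\imath_j(f))=\sum_{x\in G_j}f(x)\,d_{\chi_j}^{-1}\chi_j(x^{-1})$ for all $f\in\mathrm{Z}\ell^1(G_j)$. The function $\widetilde\omega:G\to\mathbb C$ corresponding to $\omega$ is $\widetilde\omega(x)=\prod_{i\in I}d_{\chi_i}^{-1}\chi_i(x_i)$ for $x=(x_i)_{i\in I}\in G$ (all but finitely many factors equal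 $1$). The maximal character ratio of a group character $\chi$ of a finite group $H$ is $\operatorname{mcr}(\chi)=\sup\{d_\chi^{-1}|\chi(g)| : g\in H\setminus\{e\}\}\in[0,1]$, with the supremum of the empty set (when $H$ is trivial) taken to be $0$. For a set $S$, $c_0(S)$ is the set of functions $f:S\to\mathbb C$ such that for every $\varepsilon>0$, $|f(s)|<\varepsilon$ for all but finitely many $s\in S$. *)

(* Defs.v *)
From HB Require Import structures.
From mathcomp Require Import all_boot all_order all_algebra all_fingroup.
From mathcomp Require Import mxrepresentation complex.
From mathcomp Require Import all_classical all_reals all_analysis.
From mathcomp Require summability.

Set Implicit Arguments.
Unset Strict Implicit.
Unset Printing Implicit Defensive.

Import Order.TTheory GRing.Theory Num.Theory.
Import numFieldNormedType.Exports.

Local Open Scope classical_set_scope.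
Local Open Scope ring_scope.
Local Open Scope complex_scope.

Notation normc := ComplexField.Normc.normc.

(* Equality on an arbitrary index type [I] is decided classically, by viewing
   [I] as [{classic I}], to which it is convertible. *)
Section RestrictedProduct.
Variables (I : Type) (G : I -> finGroupType).

Definition full_product := forall i : I, G i.

HB.instance Definition _ := Choice.on full_product.

Definition fp_one : full_product := fun=> 1%g.
Definition fp_mul (x y : full_product) : full_product :=
  fun i => (x i * y i)%g.
Definition fp_inv (x : full_product) : full_product := fun i => (x i)^-1%g.

Fact fp_mulA : associative fp_mul.
Proof. by move=> x y z; apply/functional_extensionality_dep => i; apply: mulgA. Qed.
Fact fp_mul1 : left_id fp_one fp_mul.
Proof. by move=> x; apply/functional_extensionality_dep => i; apply: mul1g. Qed.
Fact fp_mulr1 : right_id fp_one fp_mul.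
Proof. by move=> x; apply/functional_extensionality_dep => i; apply: mulg1. Qed.
Fact fp_mulV : left_inverse fp_one fp_inv fp_mul.
Proof. by move=> x; apply/functional_extensionality_dep => i; apply: mulVg. Qed.
Fact fp_mulrV : right_inverse fp_one fp_inv fp_mul.
Proof. by move=> x; apply/functional_extensionality_dep => i; apply: mulgV. Qed.

HB.instance Definition _ :=
  isGroup.Build full_product fp_mulA fp_mul1 fp_mulr1 fp_mulV fp_mulrV.

Definition fin_supp : pred full_product :=
  fun x => `[< finite_set [set i | x i <> 1%g] >].

Fact fin_supp_closed : group_closed fin_supp.
Proof.
split; first by apply/asboolP; apply: sub_finite_set (finite_set0 I) => i /=.
move=> x y /asboolP fx /asboolP fy; apply/asboolP.
apply: (@sub_finite_set _ _ ([set i | x i <> 1%g] `|` [set i | y i <> 1%g])).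
  move=> i /= ne1; apply/not_andP => -[x1 y1]; apply: ne1.
  by change (x i * (y i)^-1 = 1)%g; rewrite x1 y1 mulgV.
by rewrite finite_setU.
Qed.

Definition rdp := {x : full_product | fin_supp x}.

HB.instance Definition _ := SubChoice.on rdp.
HB.instance Definition _ :=
  SubChoice_isSubGroup.Build full_product fin_supp rdp fin_supp_closed.

Definition single (j : I) (x : G j) : full_product :=
  @dfwith {classic I} G fp_one j x.

Fact single_fin_supp j x : fin_supp (@single j x).
Proof.
apply/asboolP; apply: sub_finite_set (finite_set1 j) => i /= ne1.
apply: contrapT => ij; apply: ne1.
by apply: (@dfwith_out {classic I}); apply/eqP => ji; apply: ij; rewrite -ji.
Qed.

Definition incl (j : I) (x : G j) : rdp := Sub (single x) (single_fin_supp x).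

End RestrictedProduct.

Section L1.
Variables (R : realType) (H : groupType).
Local Notation C := R[i].
Implicit Types f g : H -> C.

Definition in_l1 f : Prop :=
  (\esum_(x in [set: H]) (normc (f x))%:E < +oo)%E.

(* Unordered sum: the limit of the net of finite partial sums. *)
Definition csum f : C := summability.sum (f : H -> C^o).

Definition conv f g : H -> C := fun x => csum (fun y => f y * g (y^-1 * x)%g).

Definition in_Zl1 f : Prop :=
  in_l1 f /\ forall g, in_l1 g -> conv f g = conv g f.

(* A functional on Zl1 is represented by a total map on functions, of which
   only the values on Zl1 are constrained and used. *)
Record algebra_character (om : (H -> C) -> C) : Prop := {
  achar_linear : forall (a : C) f g, in_Zl1 f -> in_Zl1 g ->
    om (fun x => a * f x + g x) = a * om f + om g;
  achar_mult : forall f g, in_Zl1 f -> in_Zl1 g -> om (conv f g) = om f * om g;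
  achar_neq0 : exists2 f, in_Zl1 f & om f <> 0 }.

End L1.

Section FiniteGroup.
Variables (R : realType) (H : finGroupType).
Local Notation C := R[i].
Implicit Types chi : H -> C.

Definition irr_group_character chi : Prop :=
  exists (n : nat) (rH : mx_representation C [set: H]%G n),
    mx_irreducible rH /\ forall x, chi x = \tr (rH x).

Definition degree chi : C := chi 1%g.

(* [sup set0 = 0] in the library, which covers the trivial group. *)
Definition mcr chi : R :=
  sup [set normc ((degree chi)^-1 * chi g) | g in [set g : H | g <> 1%g]].

End FiniteGroup.

Definition c0 (R : realType) (S : Type) (f : S -> R[i]) : Prop :=
  forall e : R, 0 < e -> finite_set [set s | ~ (normc (f s) < e)].

Section Correspondence.
Variables (R : realType) (I : Type) (G : I -> finGroupType).
Local Notation C := R[i].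

Definition extend0 (j : I) (f : G j -> C) : rdp G -> C :=
  fun x => if x == incl (val x j) then f (val x j) else 0.

Definition corresponds (om : (rdp G -> C) -> C) (chi : forall i, G i -> C) :=
  forall j, irr_group_character (chi j) /\
    forall f : G j -> C, in_Zl1 f ->
      om (extend0 f) = \sum_(x : G j) f x * (degree (chi j))^-1 * chi j x^-1%g.

(* [\big[_/_]_(i \in A)] multiplies the factors different from 1, provided
   there are finitely many of them, which is the case here. *)
Definition omega_tilde (chi : forall i, G i -> C) : rdp G -> C :=
  fun x => \big[*%R/1]_(i \in [set: {classic I}])
             ((degree (chi i))^-1 * chi i (val x i)).

End Correspondence.

(* Main.v *)
(** A representing matrix of a finite group has finite order, so it is
diagonalizable with eigenvalues of modulus 1, and every character ratio
[chi x / chi 1] has modulus at most 1. Hence the modulus of omega-tilde at [x]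
is at most that of each of its factors, and all the points where it is at least
[e] are supported in the set of indices where mcr is at least [e]; if this set
is finite, then so are the points supported in it. Conversely, omega-tilde takes
at an element of a single factor the corresponding character ratio, so each
index where mcr is at least [e] lies in the support of a point where omega-tilde
has modulus at least [e / 2]. *)

Require Import Defs.
From mathcomp Require Import all_boot all_order all_algebra all_fingroup.
From mathcomp Require Import finmap separable cyclotomic mxrepresentation complex.
From mathcomp Require Import all_classical all_reals all_analysis.

Set Implicit Arguments.
Unset Strict Implicit.
Unset Printing Implicit Defensive.

Import Order.TTheory GRing.Theory Num.Theory.

Local Open Scope ring_scope.
Local Open Scope complex_scope.

(** The minimal polynomial divides ['X^m - 1], which is separable in characteristic 0, so [A] is
    conjugate to a diagonal matrix whose entries are [m]-th roots of unity. *)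
Lemma normr_trace_finite_order (F : numClosedFieldType) (n m : nat)
    (A : 'M[F]_n.+1) : (0 < m)%N -> A ^+ m = 1 -> `|\tr A| <= n.+1%:R.
Proof.
move=> m_gt0 Am1.
have minA : mxminpoly A %| 'X^m - 1.
  by rewrite dvd_mxminpoly rmorphB rmorphXn rmorph1 /= horner_mx_X Am1 subrr.
have [rs Xm1] := closed_field_poly_normal ('X^m - 1 : {poly F}).
have Xm1_monic : 'X^m - 1 \is @monic F by exact: monicXnsubC.
rewrite (monicP Xm1_monic) scale1r in Xm1.
have /diagonalizableP [P Pu diagP] : exists2 rs : seq F,
    uniq rs & mxminpoly A %| \prod_(x <- rs) ('X - x%:P).
  exists rs; last by rewrite -Xm1.
  rewrite -separable_prod_XsubC -Xm1; apply: separable_Xn_sub_1.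
  by rewrite pnatr_eq0 -lt0n.
have -> : \tr A = \tr (mxpoly.conjmx P A).
  by rewrite mxpoly.conjumx// mxtrace_mulC mulmxA mulVmx// mul1mx.
have norm1 i : `|mxpoly.conjmx P A i i| = 1.
  have : root (mxminpoly A) (mxpoly.conjmx P A i i).
    rewrite (diagonalizable_for_mxminpoly Pu diagP) root_prod_XsubC mem_undup.
    by apply: map_f; rewrite mem_enum.
  move=> /(root_dvdp minA); rewrite rootE !hornerE subr_eq0 => /eqP rm1.
  by apply/eqP; rewrite -(@pexpr_eq1 _ _ m)// -normrX rm1 normr1.
rewrite (le_trans (ler_norm_sum _ _ _))//.
by under eq_bigr do rewrite norm1; rewrite sumr_const card_ord.
Qed.

Lemma normc_ge0 (R : rcfType) (z : R[i]) : 0 <= normc z.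
Proof. by case: z => a b; exact: sqrtr_ge0. Qed.

Section CharacterRatio.
Variables (R : realType) (H : finGroupType) (chi : H -> R[i]).
Hypothesis irr_chi : irr_group_character chi.
Local Notation ratio x := ((degree chi)^-1 * chi x).

Lemma char_ratio1 : ratio 1%g = 1.
Proof.
have [n [rH [[_ n0 _] chiE]]] := irr_chi.
rewrite /degree chiE repr_mx1 mxtrace1 mulVf// pnatr_eq0.
(* In dimension 0 the identity matrix is 0, which irreducibility excludes. *)
by case: n rH n0 {chiE} => [|n] rH //; rewrite [1%:M]flatmx0 => /eqP.
Qed.

Lemma char_ratio_le1 x : normc (ratio x) <= 1.
Proof.
have [[|n] [rH [[_ n0 _] chiE]]] := irr_chi.
  by move: n0; rewrite [1%:M]flatmx0 eqxx.
have tr_le : `|chi x| <= n.+1%:R.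
  rewrite chiE; apply: (@normr_trace_finite_order _ _ #[x]%g) => //.
  by rewrite -repr_mxX ?in_setT// expg_order repr_mx1.
(* The norm of [R[i]] is [normc] embedded in [R[i]], so the real inequality is proved there. *)
rewrite -lecR -[leLHS]/`|ratio x| normrM normfV.
rewrite /degree chiE repr_mx1 mxtrace1 normr_nat.
by rewrite mulrC ler_pdivrMr ?ltr0n// mul1r.
Qed.

Lemma char_ratio_le_mcr x : x <> 1%g -> normc (ratio x) <= mcr chi.
Proof.
move=> x1; apply: ub_le_sup; last by exists x.
by exists 1 => _ [y _ <-]; exact: char_ratio_le1.
Qed.

Lemma mcr_ge0 : 0 <= mcr chi.
Proof.
have [[x x1]|trivH] := pselect (exists x : H, x <> 1%g).
  by apply: le_trans _ (char_ratio_le_mcr x1); exact: normc_ge0.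
rewrite /mcr [X in sup X](_ : _ = set0) ?sup0//.
by rewrite -subset0 => y [x x1 _]; apply: trivH; exists x.
Qed.

Lemma lt_mcr (e : R) : 0 <= e -> e < mcr chi ->
  exists2 x, x <> 1%g & e < normc (ratio x).
Proof.
move=> e0 lt_e.
have [|_ [x x1 <-]] := sup_gt _ lt_e; last by exists x.
(* With no ratios to compare, the supremum would be 0, contradicting [0 <= e < mcr chi]. *)
apply/set0P; apply: contraTneq lt_e; rewrite /mcr => ->.
by rewrite sup0 -leNgt.
Qed.

End CharacterRatio.

Section RestrictedProductSupport.
Variables (I : Type) (G : I -> finGroupType).
Local Open Scope classical_set_scope.

Definition rdp_supp (x : rdp G) : set I := [set i | val x i <> 1%g].

Lemma finite_rdp_supp x : finite_set (rdp_supp x).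
Proof. by have /asboolP := valP x. Qed.

(** Such a point is determined by its coordinates in [F], and a finite product of finite groups is
    finite. *)
Lemma finite_rdp_supp_subset (F : set I) :
  finite_set F -> finite_set [set x : rdp G | rdp_supp x `<=` F].
Proof.
move=> finF; pose A := @fset_set {classic I} F.
(* The boolean component makes the set a full preimage under [f], on which the
   restriction to [F] is injective. *)
pose f (x : rdp G) : {dffun forall i : A, G (val i)} * bool :=
  ([ffun i : A => val x (val i)] : {dffun forall i : A, G (val i)},
   `[< rdp_supp x `<=` F >]).
rewrite (_ : [set x | _] = f @^-1` [set p | is_true p.2]); last first.
  by apply/seteqP; split=> x /= /asboolP.
apply: finite_preimage; last exact: finite_finset.
move=> x y; rewrite !inE /= => /asboolP xF /asboolP yF [xy _].
apply/val_inj/functional_extensionality_dep => i.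
have [Fi|nFi] := pselect (F i).
  have Ai : i \in A by rewrite /A (@in_fset_set {classic I})//; apply/mem_set.
  by have := congr1 (fun h : {dffun _} => h [` Ai]%fset) xy; rewrite !ffunE.
have out (z : rdp G) : rdp_supp z `<=` F -> val z i = 1%g.
  by move=> zF; apply: contrapT => /zF.
by rewrite !out.
Qed.

Lemma val_incl (j : I) (x : G j) : val (Defs.incl x) j = x.
Proof. exact: (@dfwithin {classic I}). Qed.

Lemma val_incl_out (j i : I) (x : G j) : j <> i -> val (Defs.incl x) i = 1%g.
Proof. by move=> ji; apply: (@dfwithout {classic I}); apply/eqP. Qed.

End RestrictedProductSupport.

Section OmegaTilde.
Variables (R : realType) (I : Type) (G : I -> finGroupType).
Variable chi : forall i, G i -> R[i].
Arguments chi : clear implicits.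
Hypothesis irr_chi : forall i, irr_group_character (chi i).
Local Notation ratio i x := ((degree (chi i))^-1 * chi i x).

(** Factors outside the support are ratios at the identity, hence 1. [F] may exceed the support, so
    that a chosen index can be included. *)
Lemma omega_tildeE (x : rdp G) (F : set I) : finite_set F ->
  (rdp_supp x `<=` F)%classic ->
  omega_tilde chi x =
    \big[*%R/1]_(i \in (F : set {classic I})) ratio i (val x i).
Proof.
move=> finF suppF; apply/esym/fsbig_widen => // i [_ /= Fi].
suff -> : val x i = 1%g by exact: char_ratio1.
by apply: contrapT => /suppF.
Qed.

Lemma omega_tilde_incl (j : I) (x : G j) :
  omega_tilde chi (Defs.incl x) = ratio j x.
Proof.
rewrite (omega_tildeE (finite_set1 j)); last first.
  move=> i /= xi; apply: contrapT => ij; apply: xi.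
  by apply: val_incl_out => ji; apply: ij.
by rewrite (@fsbig_set1 _ _ _ {classic I} j) val_incl.
Qed.

Lemma omega_tilde_le_ratio (x : rdp G) (j : I) :
  normc (omega_tilde chi x) <= normc (ratio j (val x j)).
Proof.
(* Adjoining [j] allows its factor to be split off even when [x] is trivial there; the other factors
   have modulus at most 1. *)
pose F : set {classic I} := (rdp_supp x `|` [set j])%classic.
have finF : finite_set F.
  by rewrite finite_setU; split; [exact: finite_rdp_supp|exact: finite_set1].
rewrite (omega_tildeE finF); last by left.
rewrite (@fsbigD1 _ _ _ {classic I} j)//; last by right.
rewrite ComplexField.Normc.normcM ler_piMr//; first by exact: normc_ge0.
apply: (big_ind (fun z : R[i] => normc z <= 1)).
- by rewrite ComplexField.Normc.normc1.
- move=> a b a1 b1; rewrite ComplexField.Normc.normcM.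
  by apply: mulr_ile1 => //; exact: normc_ge0.
- by move=> i _; exact: char_ratio_le1.
Qed.

End OmegaTilde.

Theorem theorem5p4 (R : realType) (I : Type) (G : I -> finGroupType)
    (omega : (rdp G -> R[i]) -> R[i]) (chi : forall i : I, G i -> R[i])
    (omega_char : algebra_character omega) (omega_chi : corresponds omega chi) :
  c0 (omega_tilde chi) <-> c0 (fun i : I => (mcr (chi i))%:C).
Proof.
have irr_chi i : irr_group_character (chi i) by have [] := omega_chi i.
have normc_mcr i : normc (mcr (chi i))%:C = mcr (chi i).
  by rewrite /= expr0n/= addr0 sqrtr_sqr ger0_norm// mcr_ge0.
split=> c0_om e e0.
(* Halving gives the strict inequality [e / 2 < mcr (chi i)] that [lt_mcr] requires. Finitely many
   points pass this threshold, and the union of their finite supports is finite. *)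
- have e2 : 0 < e / 2 by rewrite divr_gt0.
  apply: sub_finite_set (bigcup_finite (c0_om _ e2)
    (fun x _ => finite_rdp_supp x)) => i.
  rewrite /mkset normc_mcr => /negP; rewrite -leNgt => e_le.
  have [|x x1 lt_x] := lt_mcr (ltW e2) (lt_le_trans _ e_le).
    by rewrite ltr_pdivrMr// ltr_pMr// ltr1n.
  exists (Defs.incl x); last by rewrite /rdp_supp /mkset val_incl.
  by rewrite omega_tilde_incl//; apply/negP; rewrite -leNgt ltW.
- apply: sub_finite_set (finite_rdp_supp_subset G (c0_om _ e0)) => x.
  rewrite /mkset => /negP; rewrite -leNgt => e_le i xi.
  rewrite /mkset normc_mcr; apply/negP; rewrite -leNgt.
  (* Since [i] is in the support of [x], the ratio at [val x i] is one of those bounded by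
     [mcr (chi i)]. *)
  apply: le_trans _ (char_ratio_le_mcr (irr_chi i) xi).
  exact: le_trans e_le (omega_tilde_le_ratio irr_chi _ _).
Qed.
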